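(* Let $H$ be a graph with no isolated vertices and let $T$ be a tree with no isolated vertices (i.e. with at least two vertices). Then there exists an integer $r = r(H,T)$ (depending only on $H$ and $T$) such that $\mathrm{ex}(n, H, T) = \Theta(n^r)$.
   Context: A copy of a graph $H$ in a graph $G$ is a (not necessarily induced) subgraph of $G$ isomorphic to $H$. A graph is $F$-free if it contains no copy of $F$. For graphs $H$ and $F$ with no isolated vertices and an integer $n$, $\mathrm{ex}(n, H, F)$ denotes the maximum possible number of copies of $H$ in an $F$-free graph on $n$ vertices. The notation $\Theta$ is the usual asymptotic notation as $n \to \infty$ with $H$ and $T$ fixed, so the implied constants may depend on $H$ and $T$.
   Formalization: The formal theorem assumes in addition that H contains no copy of T; otherwise ex(n, H, T) = 0 for every n, so ex(n, H, T) = Θ(n^r) fails for every integer r (e.g. H = T = K_2). *)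

(* Defs.v *)
From HB Require Import structures.
From mathcomp Require Import all_boot.

Set Implicit Arguments.
Unset Strict Implicit.
Unset Printing Implicit Defensive.

(* Finite simple graphs on a fixed vertex type, given by their edge sets; they
   form a finType over each vertex type, so that one can maximise over all
   graphs on 'I_n. *)
Record sgraph (V : finType) := SGraph {
  edges : {set {set V}};
  _ : [forall (e | e \in edges), #|e| == 2] }.

HB.instance Definition _ (V : finType) := [isSub for @edges V].
HB.instance Definition _ (V : finType) := [Finite of sgraph V by <:].

(* Irreflexive because edges have exactly two elements. *)
Definition adj (V : finType) (G : sgraph V) : rel V :=
  fun x y => [set x; y] \in edges G.

Definition no_isolated (V : finType) (G : sgraph V) : Prop :=
  forall x : V, exists y : V, adj G x y.

Definition connected_graph (V : finType) (G : sgraph V) : Prop :=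
  0 < #|V| /\ forall x y : V, connect (adj G) x y.

(* The sequences of size at most 2 satisfying [ucycle] are the degenerate ones
   (in particular an edge traversed back and forth), hence the size bound. *)
Definition acyclic_graph (V : finType) (G : sgraph V) : Prop :=
  forall s : seq V, 2 < size s -> ~ ucycle (adj G) s.

Definition is_tree (V : finType) (G : sgraph V) : Prop :=
  connected_graph G /\ acyclic_graph G.

(* A pair (W, D) of a vertex set and an edge set is a not necessarily induced
   subgraph of G. *)
Definition subgraph (V : finType) (G : sgraph V)
    (S : {set V} * {set {set V}}) : bool :=
  (S.2 \subset edges G) && [forall (e | e \in S.2), e \subset S.1].

(* f is a graph isomorphism from H onto the graph (W, D). *)
Definition iso_onto (U V : finType) (H : sgraph U)
    (S : {set V} * {set {set V}}) : bool :=
  [exists f : {ffun U -> V},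
     [&& injectiveb f, f @: [set: U] == S.1
       & [set f @: (e : {set U}) | e in edges H] == S.2]].

(* Copies are counted as subgraphs (unlabelled), not as embeddings. *)
Definition copies (U V : finType) (H : sgraph U) (G : sgraph V) :
    {set {set V} * {set {set V}}} :=
  [set S | subgraph G S && iso_onto H S].

Definition is_free (W V : finType) (F : sgraph W) (G : sgraph V) : bool :=
  copies F G == set0.

Definition ex (U W : finType) (n : nat) (H : sgraph U) (F : sgraph W) : nat :=
  \max_(G : sgraph 'I_n | is_free F G) #|copies H G|.

Lemma is_freePn (W V : finType) (F : sgraph W) (G : sgraph V) :
  reflect (exists2 f : W -> V, injective f &
             forall e : {set W}, e \in edges F -> f @: e \in edges G)
          (~~ is_free F G).
Proof.
apply: (iffP idP).
  case/set0Pn=> -[A D]; rewrite inE => /andP[/andP[/= sDG _]].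
  case/existsP=> f /and3P[/injectiveP fI _ /eqP /= DE].
  exists f => // e eF; apply: (subsetP sDG); rewrite -DE.
  exact: imset_f.
case=> f fI fE; apply/set0Pn.
exists (f @: [set: W], [set f @: (e : {set W}) | e in edges F]).
rewrite inE; apply/andP; split.
  apply/andP; split=> /=.
    by apply/subsetP => _ /imsetP[e eF ->]; exact: fE.
  apply/forall_inP => _ /imsetP[e eF ->].
  exact/imsetS/subsetT.
have fF : finfun f =1 f by move=> x; rewrite ffunE.
apply/existsP; exists (finfun f); apply/and3P; split=> /=.
- by apply/injectiveP => x y; rewrite !fF; exact: fI.
- by apply/eqP; exact: eq_imset.
- by apply/eqP/eq_in_imset => e _; exact: eq_imset.
Qed.

(* ex(., H, F) vanishes identically when H contains F, so an estimate
   ex(n, H, F) = Theta(n^r) presupposes that H is F-free. *)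
Lemma ex_eq0 (U W : finType) (n : nat) (H : sgraph U) (F : sgraph W) :
  ~~ is_free F H -> ex n H F = 0.
Proof.
case/is_freePn=> f fI fE; apply/eqP; rewrite -leqn0.
apply/bigmax_leqP => G Gfree; rewrite leqn0 cards_eq0.
apply: contraLR Gfree => /is_freePn[g gI gE].
apply/is_freePn; exists (g \o f); first exact: inj_comp.
by move=> e eF; rewrite imset_comp; apply/gE/fE.
Qed.

(* Main.v *)
Require Import Defs.
From mathcomp Require Import all_boot.

Set Implicit Arguments.
Unset Strict Implicit.
Unset Printing Implicit Defensive.

(** The exponent r is found as follows. For a set A of vertices of H, blow H up
    around A: take many disjoint copies of H and glue together the copies of
    each vertex of A. If T is contained in no such blow-up, A is called safe.
    On n vertices, the blow-up contains at least c * n ^ k copies of H, where k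
    is the number of components of H outside A and c > 0 is a constant, because
    each component may be taken from any of the glued copies. So ex(n, H, T) is
    at least of order n ^ r, r being the largest k obtained from a
    safe A ([blowup_bound]).

    For the upper bound, let G be T-free on n vertices and consider a family F
    of embeddings of H into G. A set C of vertices of H is flexible for F if
    every member of F can be modified on C only, within F, so as to avoid on C
    any prescribed set of boundedly many vertices of G. Flexible sets are closed
    under union.

    Counting: if every nonempty subfamily F' admits a set of at most r vertices
    of H that meets all nonempty sets flexible for F', then F has O(n ^ r)
    members ([card_le_of_transversals]). This is a variant of the
    delta-system method: F splits into boundedly many classes according to the
    reason for which flexibility fails, and in each class new functional
    dependencies hold between the coordinates.

    Structure: in a T-free graph such transversals exist. Say that x is below y
    if every flexible set containing x contains y, and let X be a minimal set of
    vertices of H such that every vertex is below some element of X; X meets all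
    nonempty flexible sets. Adjacent vertices x and y of H are comparable:
    otherwise both ends of the edge could be moved while the other stays put,
    and any tree could be traced in G back and forth along the images of this
    edge ([flex_le_edge]). Let A consist of the vertices that are below at least
    two elements of X. Outside A each vertex is below exactly one element of X,
    and by comparability this element is constant on the components of H
    outside A; hence there are at least #|X| components. Finally A is safe: a
    copy of T in a blow-up around A can be unrolled into G, entering each
    component outside A through a modification on a flexible set that contains
    the component and not the vertex of A one comes from
    ([realizable_of_family]). Both uses of the hypothesis that G is T-free rest
    on one lemma, [not_free_of_flexible], which embeds T into G vertex by
    vertex. So #|X| is at most r, by the choice of r. *)

(** * Flexible and rigid coordinates in a family of functions *)

Section Families.
Variables (U V : finType) (s : nat).
Implicit Types (F : {set {ffun U -> V}}) (f g : {ffun U -> V}).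
Implicit Types (A C : {set U}) (Z : {set V}).

Definition agree_on A f g := [forall x in A, f x == g x].

Definition flexible F C :=
  [forall f in F, forall Z : {set V}, (#|Z| <= s) ==>
     [exists g in F, agree_on (~: C) f g && [forall x in C, g x \notin Z]]].

(** A functional dependency: the restriction to A of a member of F determines
    its value at some further point. *)
Definition rigid F A :=
  [exists v, (v \notin A) &&
     [forall f in F, forall g in F, agree_on A f g ==> (f v == g v)]].

Lemma agree_onP A f g : reflect {in A, f =1 g} (agree_on A f g).
Proof. by apply: (iffP forall_inP) => fg x /fg /eqP. Qed.

Lemma flexibleP F C :
  reflect (forall f Z, f \in F -> #|Z| <= s -> exists g,
             [/\ g \in F, {in ~: C, f =1 g} & {in C, forall x, g x \notin Z}])
          (flexible F C).
Proof.
apply: (iffP forall_inP) => [fl f Z fF Zs|fl f fF].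
  have /existsP[g /and3P[gF /agree_onP fg /forall_inP gZ]] :=
    implyP (forallP (fl f fF) Z) Zs.
  by exists g.
apply/forallP=> Z; apply/implyP=> Zs; have [g [gF fg gZ]] := fl f Z fF Zs.
by apply/existsP; exists g; rewrite gF /=; apply/andP; split;
  [apply/agree_onP | apply/forall_inP].
Qed.

Lemma flexible0 F : flexible F set0.
Proof.
apply/flexibleP=> f Z fF _; exists f; split=> // x.
by rewrite inE.
Qed.

(** Modify on C1 first, then on C2: on C1 minus C2 the second modification keeps
    the values of the first one, which already avoid Z. *)
Lemma flexibleU F C1 C2 : flexible F C1 -> flexible F C2 -> flexible F (C1 :|: C2).
Proof.
move=> /flexibleP fl1 /flexibleP fl2; apply/flexibleP=> f Z fF Zs.
have [f1 [f1F ff1 f1Z]] := fl1 f Z fF Zs.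
have [f2 [f2F f12 f2Z]] := fl2 f1 Z f1F Zs.
exists f2; split=> // [x|x xC].
  rewrite !inE negb_or => /andP[x1 x2].
  by rewrite ff1 ?inE // f12 // inE.
have [x2|x2] := boolP (x \in C2); first exact: f2Z.
by rewrite -f12 ?inE // f1Z //; move: xC; rewrite inE (negPf x2) orbF.
Qed.

Lemma flexible_bigcup F (I : finType) (P : pred I) (C : I -> {set U}) :
  (forall i, P i -> flexible F (C i)) -> flexible F (\bigcup_(i | P i) C i).
Proof.
by move=> fl; elim/big_ind: _ => //; [exact: flexible0 | exact: flexibleU].
Qed.

Lemma rigid_sub F F' A : F' \subset F -> rigid F A -> rigid F' A.
Proof.
move=> /subsetP sF /existsP[v /andP[vA /forall_inP rF]].
apply/existsP; exists v; rewrite vA; apply/forall_inP=> f fF.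
by apply/forall_inP=> g gF; apply: (forall_inP (rF f _)); apply: sF.
Qed.

(** If flexibility of the complement of A fails at f, some small Z meets outside
    A every member of the fibre {g | g agrees with f on A}. Remove this fibre
    and give each of its members g the label (A, v, i), where v lies outside A
    and g v is the i-th element of Z. Members with the same label that agree on
    A come from the same fibre, hence agree at v as well. Once no fibre can be
    removed, the remaining members (label None) form a flexible family. *)
Lemma peeling (P : pred {set U}) F :
  exists c : {ffun U -> V} -> option ({set U} * U * 'I_s.+1),
    (forall A, P A -> flexible [set f in F | c f == None] (~: A)) /\
    (forall A v i, {in F, forall f, c f = Some (A, v, i) ->
       [/\ P A, v \notin A &
        {in F, forall g, c g = Some (A, v, i) -> agree_on A f g -> f v = g v}]}).
Proof.
have [m] := ubnP #|F|; elim: m F => // m IH F Fm.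
have [/forall_inP flF|] := boolP [forall A in P, flexible F (~: A)].
  exists (fun=> None); split=> // A /flF.
  by apply: etrans; congr flexible; apply/setP=> f; rewrite !inE andbT.
rewrite negb_forall_in => /exists_inP[A PA nfl].
have [f [Z [fF Zs noesc]]] : exists f Z, [/\ f \in F, #|Z| <= s &
    {in F, forall g, agree_on A f g -> exists2 v, v \notin A & g v \in Z}].
  move: nfl; rewrite negb_forall_in => /exists_inP[f fF].
  rewrite negb_forall => /existsP[Z]; rewrite negb_imply => /andP[Zs nex].
  exists f, Z; split=> // g gF fg.
  move: nex; rewrite negb_exists => /forallP /(_ g).
  rewrite gF /= setCK fg /= negb_forall_in => /exists_inP[v].
  by rewrite inE negbK; exists v.
pose fib g := agree_on A f g.
have [|c [cfl ccl]] := IH (F :\: [set g | fib g]).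
  rewrite ltnS in Fm; apply: leq_trans Fm; apply: proper_card.
  apply/properP; split; first exact: subsetDl.
  by exists f => //; rewrite !inE fF andbT negbK; apply/agree_onP.
pose hit g : option ({set U} * U * 'I_s.+1) :=
  omap (fun v => (A, v, inord (index (g v) (enum Z))))
    [pick v | (v \notin A) && (g v \in Z)].
have hitN g : g \in F -> fib g -> exists v,
    [/\ hit g = Some (A, v, inord (index (g v) (enum Z))), v \notin A & g v \in Z].
  move=> gF fg; rewrite /hit; case: pickP => [v /andP[vA vZ]|no].
    by exists v.
  by have [v vA vZ] := noesc g gF fg; have := no v; rewrite vA vZ.
exists (fun g => if fib g then hit g else c g); split.
  move=> B PB; rewrite (_ : [set _ in _ | _] =
      [set g in F :\: [set g | fib g] | c g == None]); first exact: cfl.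
  apply/setP=> g; rewrite !inE; case: ifP => [fg|//] /=.
  apply/negbTE/negP=> /andP[gF]; have [v [-> _ _]] := hitN g gF fg.
  by [].
move=> B v i g gF; case: ifP => [fg|nfg] cg.
  have [v' [hg vA gvZ]] := hitN g gF fg.
  move: cg; rewrite hg => -[EB Ev Ei]; subst B v'; split=> // g' g'F.
  case: ifP => [fg'|nfg'] cg' gg'; last first.
    case/negP: nfg'; apply/agree_onP=> x xA.
    by rewrite (agree_onP _ _ _ fg) // (agree_onP _ _ _ gg').
  have [v' [hg' _ g'vZ]] := hitN g' g'F fg'.
  move: cg'; rewrite hg' => -[Ev' Ei']; subst v'.
  have bnd z : z \in Z -> index z (enum Z) < s.+1.
    by move=> zZ; rewrite ltnS (leq_trans _ Zs) // cardE ltnW // index_mem mem_enum.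
  have := congr1 val (etrans Ei (esym Ei')); rewrite /= !inordK ?bnd // => E.
  have zE z : z \in Z -> z = nth (g v) (enum Z) (index z (enum Z)).
    by move=> zZ; rewrite nth_index ?mem_enum.
  by rewrite (zE _ gvZ) (zE _ g'vZ) E.
have gF' : g \in F :\: [set g | fib g] by rewrite !inE nfg.
have [PB vB uniq] := ccl B v i g gF' cg; split=> // g' g'F.
case: ifP => [fg'|nfg'] cg' gg'; last by apply: uniq=> //; rewrite !inE nfg'.
have [v' [hg' _ _]] := hitN g' g'F fg'.
move: cg'; rewrite hg' => -[EB _ _]; subst B.
case/negP: nfg; apply/agree_onP=> x xA.
by rewrite (agree_onP _ _ _ fg') // (agree_onP _ _ _ gg').
Qed.

(** A member of F is determined by its restriction to X: two members that agree
    on a proper superset of X agree at one more point. *)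
Lemma card_le_of_rigid F (X : {set U}) :
  (forall A, X \subset A -> A != setT -> rigid F A) -> #|F| <= #|V| ^ #|X|.
Proof.
move=> rig; pose p f : {ffun {x | x \in X} -> V} := [ffun x => f (val x)].
rewrite (_ : #|X| = #|{: {x | x \in X}}|); last by rewrite card_sig.
rewrite -card_ffun -(card_in_imset (f := p) (D := mem F)) ?max_card //.
move=> f g fF gF pfg; pose A := [set x | f x == g x].
have XA : X \subset A.
  apply/subsetP=> x xX; rewrite inE.
  by have := congr1 (fun q : {ffun _} => q (exist _ x xX)) pfg; rewrite !ffunE => /= ->.
have [AT|/(rig A XA)/existsP[v /andP[vA /forall_inP rf]]] := eqVneq A setT.
  by apply/ffunP=> x; have := in_setT x; rewrite -AT inE => /eqP.
case/negP: vA; rewrite inE; apply: (implyP (forall_inP (rf f fF) g gF)).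
by apply/agree_onP=> x; rewrite inE => /eqP.
Qed.

(** Induction on the number of sets that are not rigid for F. After [peeling]
    over these sets, each labelled class has one more rigid set. Among the
    unlabelled members, every set is rigid or has a flexible complement, so
    every proper superset of a transversal X of the flexible sets is rigid. *)
Lemma card_le_of_transversals (k : nat) F :
    0 < #|V| ->
    (forall F', F' \subset F -> F' != set0 -> exists2 X : {set U}, #|X| <= k &
       forall C, flexible F' C -> C != set0 -> ~~ [disjoint X & C]) ->
  #|F| <= #|{: option ({set U} * U * 'I_s.+1)}| ^ #|[set A | ~~ rigid F A]|
           * #|V| ^ k.
Proof.
move=> V0; set K := #|{: option ({set U} * U * 'I_s.+1)}|.
have [m] := ubnP #|[set A | ~~ rigid F A]|.
elim: m F => // m IH F Fm trans.
have [c [cfl crig]] := peeling [pred A | ~~ rigid F A] F.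
pose cls o := [set f in F | c f == o].
have sub_cls o : cls o \subset F by apply/subsetP=> f; rewrite inE => /andP[].
have trans_cls o F' : F' \subset cls o -> F' != set0 ->
    exists2 X : {set U}, #|X| <= k &
      forall C, flexible F' C -> C != set0 -> ~~ [disjoint X & C].
  by move=> sF; apply: trans; apply: subset_trans (sub_cls o).
have K0 : 0 < K by apply/card_gt0P; exists None.
set N := #|[set A | ~~ rigid F A]| in Fm *.
have survivors : #|cls None| <= #|V| ^ k.
  have [->|F0] := eqVneq (cls None) set0; first by rewrite cards0.
  have [X Xk hitX] := trans_cls None _ (subxx _) F0.
  apply: leq_trans (leq_pexp2l V0 Xk).
  apply: card_le_of_rigid => A XA AT; have [//|nrA] := boolP (rigid (cls None) A).
  have nrF : ~~ rigid F A by apply: contraNN nrA; exact: rigid_sub (sub_cls _).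
  have A0 : ~: A != set0.
    by apply: contraNneq AT => A0; rewrite -[A]setCK A0 setC0.
  by have := hitX (~: A) (cfl A nrF) A0; rewrite -subsets_disjoint XA.
have [N0|N0] := posnP N.
  rewrite N0 expn0 mul1n; apply: leq_trans survivors; apply: subset_leq_card.
  apply/subsetP=> f fF; rewrite inE fF /=; case E: (c f) => [[[A v] i]|] //.
  have [/= nr _ _] := crig A v i f fF E.
  by have := in_set0 A; rewrite -(cards0_eq N0) inE nr.
have each o : #|cls o| <= K ^ N.-1 * #|V| ^ k.
  case: o => [[[A v] i]|]; last first.
    by apply: leq_trans survivors _; rewrite leq_pmull // expn_gt0 K0.
  have [->|] := eqVneq (cls (Some (A, v, i))) set0; first by rewrite cards0.
  case/set0Pn=> f; rewrite inE => /andP[fF /eqP cf].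
  have [nr vA _] := crig A v i f fF cf.
  set F' := cls _.
  have lt : #|[set B | ~~ rigid F' B]| < N.
    apply: proper_card; apply/properP; split.
      apply/subsetP=> B; rewrite !inE; apply: contraNN.
      exact: rigid_sub (sub_cls _).
    exists A; rewrite ?inE // negbK; apply/existsP; exists v; rewrite vA.
    apply/forall_inP=> g; rewrite inE => /andP[gF /eqP cg].
    apply/forall_inP=> g'; rewrite inE => /andP[g'F /eqP cg'].
    apply/implyP=> gg'; apply/eqP; have [_ _] := crig A v i g gF cg.
    exact.
  have lt' : #|[set B | ~~ rigid F' B]| < m by apply: leq_trans lt _.
  apply: leq_trans (IH F' lt' (trans_cls _)) _.
  by rewrite leq_mul2r leq_pexp2l ?orbT // -ltnS prednK.
rewrite -(prednK N0) expnS -mulnA.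
rewrite -sum1_card (partition_big c predT) //= -sum_nat_const.
by apply: leq_sum => o _; apply: leq_trans (each o); rewrite sum1dep_card.
Qed.
End Families.

(** * Growing a tree inside a graph *)

Section Trees.
Variable (W : finType).
Implicit Types T : sgraph W.

Lemma adj_sym (V : finType) (G : sgraph V) : symmetric (adj G).
Proof. by move=> x y; rewrite /adj setUC. Qed.

Lemma adj_irr (V : finType) (G : sgraph V) x : adj G x x = false.
Proof.
apply/negP; rewrite /adj; case: G => E /= /forall_inP E2 /E2.
by rewrite setUid cards1.
Qed.

Lemma edgeP (V : finType) (G : sgraph V) e :
  e \in edges G -> exists x y, e = [set x; y] /\ adj G x y.
Proof.
move=> eG; have : #|e| == 2 by case: G eG => E /= /forall_inP; apply.
by case/cards2P=> x [y [_ E]]; exists x, y; rewrite /adj -E.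
Qed.

(** S is kept connected, so that two neighbours of q in S would be joined by a
    path inside S, which q closes into a cycle. *)
Lemma tree_growth T (P : {set W} -> Prop) :
  is_tree T -> (forall r, P [set r]) ->
  (forall (S : {set W}) p q, P S -> p \in S -> q \notin S -> adj T p q ->
     {in S, forall p', adj T p' q -> p' = p} -> P (q |: S)) ->
  P [set: W].
Proof.
move=> [[/card_gt0P[r _] conn] acyc] P1 Pgrow.
pose rS (S : {set W}) := [rel x y | [&& adj T x y, x \in S & y \in S]].
suff grow m (S : {set W}) : #|~: S| = m -> S != set0 ->
    {in S &, forall a b, connect (rS S) a b} -> P S -> P setT.
  apply: (grow _ [set r]) => //; first by apply/set0Pn; exists r; rewrite inE.
  by move=> a b; rewrite !inE => /eqP-> /eqP->; apply: connect0.
elim: m S => [|m IH] S Sm S0 Sconn PS.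
  by rewrite -[setT]setC0 -(cards0_eq Sm) setCK.
have [z zS] : exists z, z \in ~: S by apply/set0Pn; rewrite -cards_eq0 Sm.
have [a aS] := set0Pn _ S0.
have [p [q [pS qS pq]]] : exists p q, [/\ p \in S, q \notin S & adj T p q].
  have /connectP[t tp tz] := conn a z; move: zS; rewrite {}tz inE => zS.
  elim: t a aS tp zS {S0} => [a ->//|b t IHt a aS] /= /andP[ab tp] zS.
  have [bS|bS] := boolP (b \in S); first exact: IHt tp zS.
  by exists a, b.
have qS_conn a' b' : connect (rS S) a' b' -> connect (rS (q |: S)) a' b'.
  apply: connect_sub => x y /and3P[xy xS yS]; apply: connect1.
  by rewrite /= xy !inE xS yS !orbT.
have sym (S' : {set W}) : connect_sym (rS S').
  apply: sym_connect_sym => x y; rewrite /= adj_sym.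
  by congr (_ && _); rewrite andbC.
have cqp : connect (rS (q |: S)) q p.
  by rewrite sym; apply: connect1; rewrite /= pq !inE pS eqxx orbT.
apply: (IH (q |: S)).
- have -> : ~: (q |: S) = ~: S :\ q by apply/setP=> x; rewrite !inE negb_or.
  by apply/eqP; rewrite -eqSS -Sm (cardsD1 q (~: S)) inE qS.
- by apply/set0Pn; exists q; rewrite !inE eqxx.
- move=> x y; rewrite !inE => /orP[/eqP->|xS] /orP[/eqP->|yS].
  + exact: connect0.
  + exact: connect_trans cqp (qS_conn _ _ (Sconn _ _ pS yS)).
  + rewrite sym; exact: connect_trans cqp (qS_conn _ _ (Sconn _ _ pS xS)).
  + exact: qS_conn (Sconn _ _ xS yS).
apply: (Pgrow S p q) => // p' p'S p'q; apply/eqP/negPn/negP=> np.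
have /connectP[t0 tp tl] := Sconn p' p p'S pS.
case/shortenP: tp tl => t tp tu _ tl.
have tS : {subset p' :: t <= S}.
  clear tl tu np p'q; elim: t p' p'S tp => [x xS _ y|y t IHt x xS /=].
    by rewrite inE => /eqP->.
  move=> /andP[/and3P[_ _ yS] tp] w.
  by rewrite inE => /orP[/eqP->//|]; apply: IHt.
apply: (acyc (q :: p' :: t)).
  by case: t tl {tp tu tS} np => //= <-; rewrite eqxx.
apply/andP; split; last by rewrite cons_uniq tu andbT; apply: contra qS; apply: tS.
rewrite /= rcons_path -tl pq adj_sym p'q andbT.
by apply: sub_path tp => x y /and3P[].
Qed.

Definition embeddings (U V : finType) (H : sgraph U) (G : sgraph V) :
    {set {ffun U -> V}} :=
  [set f : {ffun U -> V} | injectiveb f &&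
     [forall x, forall y, adj H x y ==> adj G (f x) (f y)]].

Lemma embeddingsP (U V : finType) (H : sgraph U) (G : sgraph V) (f : {ffun U -> V}) :
  reflect (injective f /\ {homo f : x y / adj H x y >-> adj G x y})
          (f \in embeddings H G).
Proof.
rewrite inE; apply: (iffP andP) => -[/injectiveP fI fH]; split=> //.
  by move=> x y xy; apply: (implyP (forallP (forallP fH x) y)).
by apply/forallP=> x; apply/forallP=> y; apply/implyP; apply: fH.
Qed.

Lemma not_freeP (V : finType) T (G : sgraph V) :
  reflect (exists2 f : W -> V, injective f & {homo f : x y / adj T x y >-> adj G x y})
          (~~ is_free T G).
Proof.
apply: (iffP (is_freePn _ _)) => -[f fI fE]; exists f => //.
  by move=> x y /fE; rewrite imsetU !imset_set1.
by move=> e /edgeP[x [y [-> /fE]]]; rewrite imsetU !imset_set1.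
Qed.

(** T is mapped to G along psi : T -> H: each vertex p of T receives a member
    Phi p of F, and is sent to Phi p (psi p). When a new vertex q is attached to
    p, Phi q is a modification of Phi p on a flexible set C that avoids psi p,
    so that p keeps its image when computed with Phi q, and the edge from p to q
    is mapped to an edge. On C the new values avoid everything used before.

    Injectivity has to be argued only between vertices of T with the same image
    in H. The sets D p are there for that purpose: for p and q with different
    kappa, Phi p and Phi q differ at every element of D p :&: D q. The
    condition on C says that this is maintained from p to q, either because C
    refreshes a coordinate or because q inherits it from p. *)
Lemma not_free_of_flexible (U V : finType) T (H : sgraph U) (G : sgraph V) s
    (F : {set {ffun U -> V}}) (K : eqType) (psi : W -> U) (kappa : W -> K)
    (D : W -> {set U}) :
  is_tree T -> #|W| * #|U| <= s -> F != set0 -> F \subset embeddings H G ->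
  {homo psi : p q / adj T p q >-> adj H p q} ->
  (forall p q, adj T p q -> exists C, [/\ flexible s F C, psi p \notin C &
     {in D q, forall x, x \in C \/ x \in D p /\ kappa q = kappa p}]) ->
  (forall p q, p != q -> psi p = psi q ->
     [/\ psi p \in D p, psi q \in D q & kappa p != kappa q]) ->
  ~~ is_free T G.
Proof.
move=> treeT sbig /set0Pn[f0 f0F] /subsetP sF homp step inj.
have emb f : f \in F -> injective f /\ {homo f : x y / adj H x y >-> adj G x y}.
  by move=> /sF/embeddingsP.
pose inv (S : {set W}) := exists Phi : W -> {ffun U -> V},
  [/\ {in S, forall p, Phi p \in F},
      {in S &, forall p q x y, Phi p x = Phi q y -> x = y},
      {in S &, forall p q, adj T p q -> adj G (Phi p (psi p)) (Phi q (psi q))} &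
      {in S &, forall p q x, x \in D p -> x \in D q -> kappa p != kappa q ->
         Phi p x != Phi q x}].
suff [Phi [_ Pinj Phom PD]] : inv setT.
  apply/not_freeP; exists (fun p => Phi p (psi p)); last first.
    by move=> p q; apply: Phom; rewrite inE.
  move=> p q pq; apply/eqP/negPn/negP=> npq.
  have psipq := Pinj _ _ (in_setT p) (in_setT q) _ _ pq.
  have [Dp Dq kpq] := inj p q npq psipq.
  rewrite -psipq in Dq pq.
  by have := PD p q (in_setT p) (in_setT q) _ Dp Dq kpq; rewrite pq eqxx.
apply: (tree_growth treeT) => [r|S p q [Phi [PF Pinj Phom PD]] pS qS pq puniq].
  exists (fun=> f0); split=> // [p q _ _ x y|p q|p q].
  - exact: (emb _ f0F).1.
  - by rewrite !inE => /eqP-> /eqP->; rewrite adj_irr.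
  - by rewrite !inE => /eqP-> /eqP-> x _ _; rewrite eqxx.
have [C [/flexibleP flC pC Dq]] := step p q pq.
(* Z collects all values of all members chosen so far, not only the images of
   vertices of T: this keeps the images of distinct vertices of H disjoint. *)
pose Z := \bigcup_(r in S) [set Phi r x | x in [set: U]].
have PhiZ r x : r \in S -> Phi r x \in Z.
  by move=> rS; apply/bigcupP; exists r => //; apply: imset_f.
have Zs : #|Z| <= s.
  apply: leq_trans sbig; apply: (@leq_trans (\sum_(r in S) #|U|)).
    rewrite /Z; elim/big_rec2: _ => [|r m B _ le]; first by rewrite cards0.
    apply: leq_trans (leq_add (leqnn _) le).
    apply: leq_trans (leq_card_setU _ _) _; rewrite leq_add2r.
    by apply: leq_trans (leq_imset_card _ _) _; rewrite cardsT.
  by rewrite sum_nat_const leq_mul2r max_card orbT.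
have [g [gF gp gZ]] := flC (Phi p) Z (PF p pS) Zs.
have gold r x y : r \in S -> g x = Phi r y -> x = y.
  move=> rS E; have [xC|xC] := boolP (x \in C).
    by have := gZ x xC; rewrite E PhiZ.
  by apply: (Pinj p r) => //; rewrite gp ?inE.
have gq x r : r \in S -> x \in D q -> x \in D r -> kappa q != kappa r ->
    g x != Phi r x.
  move=> rS xq xr kqr; have [xC|xC] := boolP (x \in C).
    by apply/eqP=> E; have := gZ x xC; rewrite E PhiZ.
  have [xC'|[xp kqp]] := Dq x xq; first by rewrite xC' in xC.
  by rewrite -gp ?inE //; apply: PD => //; rewrite -kqp.
have gpq : adj G (Phi p (psi p)) (g (psi q)).
  by rewrite gp ?inE //; apply: (emb g gF).2; apply: homp.
exists (fun r => if r == q then g else Phi r); split.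
- by move=> r; rewrite !inE; case: eqVneq => //= _; apply: PF.
- move=> r r'; rewrite !inE; case: eqVneq => /= [_ _|_ rS];
    case: eqVneq => /= [_ _|_ r'S] // x y.
  + exact: (emb g gF).1.
  + exact: gold.
  + by move=> E; symmetry; apply: gold (esym E).
  + by apply: Pinj.
- move=> r r'; rewrite !inE; case: eqVneq => /= [-> _|_ rS];
    case: eqVneq => /= [-> _|_ r'S] //.
  + by rewrite adj_irr.
  + by rewrite adj_sym => r'q; rewrite (puniq _ r'S r'q) adj_sym.
  + by move=> rq; rewrite (puniq _ rS rq).
  + exact: Phom.
- move=> r r'; rewrite !inE; case: eqVneq => /= [-> _|_ rS];
    case: eqVneq => /= [-> _|_ r'S] // x.
  + by rewrite eqxx.
  + exact: gq.
  + by move=> xr xq rq; rewrite eq_sym gq // eq_sym.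
  + exact: PD.
Qed.
End Trees.

(** * Safe sets and the upper bound *)

Section UpperBound.
Variables (U W : finType) (H : sgraph U) (T : sgraph W).
Implicit Types (A X : {set U}).

(** The vertices of the blow-up of H around A are pairs (x, i), where i is
    immaterial for x in A; (x, i) and (y, j) are adjacent if x and y are, unless
    both lie outside A and i differs from j. The maps psi and kappa are the two
    components of a homomorphism from T to this blow-up, and the conclusion is
    that it is not injective. *)
Definition safe A : Prop :=
  forall (psi : W -> U) (kappa : W -> nat),
    (forall p q, adj T p q -> adj H (psi p) (psi q) /\
       [|| psi p \in A, psi q \in A | kappa p == kappa q]) ->
  exists p q, [/\ p != q, psi p = psi q & (psi p \in A) || (kappa p == kappa q)].

(** A function that is constant on the components of H outside A takes at most
    as many values there as there are components, with equality for some
    function; so this says that some safe A leaves at least k components. *)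
Definition realizable (k : nat) : Prop :=
  exists A (l : U -> U), [/\ safe A,
    forall x y, x \notin A -> y \notin A -> adj H x y -> l x = l y &
    #|l @: (~: A)| = k].

(** In a dominating set that is minimal for inclusion, an element below another
    one could be discarded. *)
Lemma minimal_dominating (le : rel U) : reflexive le -> transitive le ->
  exists X : {set U}, (forall x, exists2 y, y \in X & le x y) /\
    {in X &, forall y z, le y z -> y = z}.
Proof.
move=> le_refl le_trans.
pose dom X := [forall x, exists y in X, le x y].
have [|X /minsetP[domX minX] _] := @minset_exists _ dom setT.
  by apply/forallP=> x; apply/exists_inP; exists x; rewrite ?inE.
exists X; split=> [x|y z yX zX yz].
  by have /exists_inP := forallP domX x.
apply/eqP/negPn/negP=> nyz; suff : y \notin X by rewrite yX.
rewrite -(minX (X :\ y)) ?subD1set ?inE ?eqxx //.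
apply/forallP=> x; have /exists_inP[w wX xw] := forallP domX x.
apply/exists_inP; have [wy|wy] := eqVneq w y.
  by exists z; rewrite ?inE ?zX 1?eq_sym ?nyz //; apply: le_trans xw _; rewrite wy.
by exists w; rewrite ?inE ?wX ?wy.
Qed.

Hypothesis treeT : is_tree T.

Lemma tree_bipartite :
  exists col : W -> bool, forall p q, adj T p q -> col p != col q.
Proof.
suff [col colP] : exists col : W -> bool,
    {in [set: W] &, forall p q, adj T p q -> col p != col q}.
  by exists col => p q; apply: colP; rewrite inE.
pose P (S : {set W}) := exists col : W -> bool,
  {in S &, forall p q, adj T p q -> col p != col q}.
apply: (@tree_growth _ T P) => // [r|S p q [col colP] pS qS pq puniq].
  by exists xpredT => p q; rewrite !inE => /eqP-> /eqP->; rewrite adj_irr.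
have Eq r : r \in S -> (r == q) = false.
  by move=> rS; apply: contraNF qS => /eqP<-.
exists (fun r => if r == q then ~~ col p else col r) => r r'; rewrite !inE.
case/predU1P=> [->|rS] /predU1P[->|r'S]; rewrite ?eqxx ?Eq //.
- by rewrite adj_irr.
- by rewrite adj_sym => /(puniq _ r'S)->; case: (col p).
- by move=> /(puniq _ rS)->; case: (col p).
- exact: colP.
Qed.

Section Family.
Variables (V : finType) (G : sgraph V) (F : {set {ffun U -> V}}).
Hypotheses (freeG : is_free T G) (F0 : F != set0) (embF : F \subset embeddings H G).
Let s := #|W| * #|U|.

Definition flex_le : rel U :=
  [rel x y | [forall C, flexible s F C ==> (x \in C) ==> (y \in C)]].

Lemma flex_leP x y :
  reflect (forall C, flexible s F C -> x \in C -> y \in C) (flex_le x y).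
Proof.
apply: (iffP forallP) => le C; last by apply/implyP=> fC; apply/implyP/le.
by move=> fC; apply/implyP; have := implyP (le C) fC.
Qed.

Lemma flex_leN x y :
  ~~ flex_le x y -> exists C, [/\ flexible s F C, x \in C & y \notin C].
Proof.
rewrite negb_forall => /existsP[C]; rewrite !negb_imply => /and3P[? ? ?].
by exists C.
Qed.

(** Map the two colour classes of T to x and y. Since x and y are incomparable,
    each of them lies in a flexible set that avoids the other, so every step
    along T can be made to a vertex not used before. *)
Lemma flex_le_edge x y : adj H x y -> flex_le x y || flex_le y x.
Proof.
move=> xy; apply: contraLR freeG; rewrite negb_or => /andP[].
move=> /flex_leN[C1 [fC1 xC1 yC1]] /flex_leN[C2 [fC2 yC2 xC2]].
have [col colP] := tree_bipartite.
pose psi p := if col p then x else y.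
apply: (@not_free_of_flexible W U V T H G s F W psi id (fun p => [set psi p])) => //.
- by move=> p q /colP; rewrite /psi; case: (col p); case: (col q) => //; rewrite adj_sym.
- move=> p q /colP npq; exists (if col q then C1 else C2).
  by move: npq; rewrite /psi; case: (col p); case: (col q) => // _; split=> // z;
    rewrite inE => /eqP->; left.
- by move=> p q npq _; rewrite !inE.
Qed.

(** Here S x is the set of elements of X above x, and l x is one of them, the
    only one when x lies outside A. The order is reversed by S, so S takes
    comparable values at the ends of an edge; being singletons outside A, they
    are equal there. *)
Lemma realizable_of_family X :
  (forall x, exists2 y, y \in X & flex_le x y) ->
  {in X &, forall y z, flex_le y z -> y = z} -> realizable #|X|.
Proof.
move=> domX antiX.
have le_trans x y z : flex_le x y -> flex_le y z -> flex_le x z.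
  by move=> /flex_leP xy /flex_leP yz; apply/flex_leP=> C fC /(xy C fC); apply: yz.
pose S x := [set y in X | flex_le x y].
have [A AE] : exists A : {set U}, forall x, (x \in A) = (1 < #|S x|).
  by exists [set x | 1 < #|S x|] => x; rewrite inE.
pose l x := odflt x [pick y in S x].
have lS x : l x \in S x.
  rewrite /l; case: pickP => //= no; have [y yX xy] := domX x.
  by have := no y; rewrite inE yX xy.
have SE x : x \notin A -> S x = [set l x].
  rewrite AE -leqNgt => Sx; apply/esym/eqP.
  by rewrite eqEcard sub1set lS cards1.
have Sle x y : flex_le x y -> S y \subset S x.
  move=> xy; apply/subsetP=> z; rewrite !inE => /andP[-> yz].
  exact: le_trans yz.
have ledge x y : x \notin A -> y \notin A -> adj H x y -> l x = l y.
  move=> xA yA /flex_le_edge/orP[] /Sle.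
    by rewrite !SE // sub1set inE => /eqP.
  by rewrite !SE // sub1set inE => /eqP.
have lX : l @: (~: A) = X.
  apply/setP=> y; apply/imsetP/idP => [[x _ ->]|yX].
    by have := lS x; rewrite inE => /andP[].
  have Sy : S y = [set y].
    apply/setP=> z; rewrite !inE; apply/andP/eqP=> [[zX yz]|->].
      by rewrite (antiX y z).
    by split=> //; apply/flex_leP.
  have yA : y \notin A by rewrite AE Sy cards1.
  exists y; first by rewrite in_setC.
  by have := lS y; rewrite Sy inE => /eqP.
exists A, l; split; [|exact: ledge|by rewrite lX].
move=> psi kappa hom.
have [/existsP[p /existsP[q /and3P[npq /eqP pq cpq]]]|ninj] := boolP [exists p,
    exists q, [&& p != q, psi p == psi q & (psi p \in A) || (kappa p == kappa q)]].
  by exists p, q.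
have inj p q : p != q -> psi p = psi q -> psi p \notin A /\ kappa p != kappa q.
  move=> npq pq; apply/andP; rewrite -negb_or; apply: contraNN ninj => c.
  by apply/existsP; exists p; apply/existsP; exists q; rewrite npq pq eqxx -pq.
(* D p is the union of the components labelled l (psi p), or empty if psi p
   lies in A: at the vertices of A no two vertices of T compete. *)
pose D p := [set x | [&& psi p \notin A, x \notin A & l x == l (psi p)]].
suff : ~~ is_free T G by rewrite freeG.
apply: (@not_free_of_flexible W U V T H G s F nat psi kappa D) => //.
- by move=> p q /hom[].
- move=> p q pq; have [hpq] := hom p q pq.
  have [qA _|qA /=] := boolP (psi q \in A).
    exists set0; split; rewrite ?inE ?flexible0 // => x.
    by rewrite inE qA.
  have [pA _|pA /= /eqP kpq] := boolP (psi p \in A); last first.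
    exists set0; split; rewrite ?inE ?flexible0 // => x.
    rewrite !inE pA => /and3P[_ -> /eqP->]; right; split=> //=.
    by rewrite (ledge _ _ pA qA hpq).
  (* An edge entering the component of psi q from psi p in A. Since psi p is
     below two elements of X, it is below some j other than l (psi q). Flexible
     sets that avoid j avoid psi p; their union contains the whole component,
     because its vertices are not below j. *)
  have [j jp jq] : exists2 j, j \in S (psi p) & j != l (psi q).
    move: pA; rewrite AE (cardsD1 (l (psi q))) => lt.
    have /card_gt0P[j] : 0 < #|S (psi p) :\ l (psi q)|.
      by move: lt; case: (_ \in _) => //; rewrite add0n => /ltnW.
    by rewrite 2!inE => /andP[? ?]; exists j.
  exists (\bigcup_(C | flexible s F C && (j \notin C)) C); split.
  + by apply: flexible_bigcup => C /andP[].
  + apply/bigcupP=> -[C /andP[fC jC] pC]; case/negP: jC.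
    by move: jp; rewrite inE => /andP[_ /flex_leP]; apply.
  + move=> x; rewrite inE => /and3P[_ xA /eqP lx]; left.
    have : ~~ flex_le x j.
      move: jq; rewrite -lx; apply: contraNN => xj.
      by rewrite -in_set1 -SE // inE xj andbT; move: jp; rewrite inE => /andP[].
    case/flex_leN=> C [fC xC jC].
    by apply/bigcupP; exists C; rewrite ?fC.
- move=> p q npq pq; have [pA kpq] := inj p q npq pq.
  by rewrite !inE -pq pA eqxx.
Qed.
End Family.

Lemma embeddings_bound (V : finType) (G : sgraph V) r :
  0 < #|V| -> is_free T G -> (forall k, realizable k -> k <= r) ->
  #|embeddings H G| <=
    #|{: option ({set U} * U * 'I_(#|W| * #|U|).+1)}| ^ #|{set U}| * #|V| ^ r.
Proof.
move=> V0 freeG rmax.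
apply: leq_trans (@card_le_of_transversals _ _ (#|W| * #|U|) r _ V0 _) _; last first.
  rewrite leq_mul2r leq_pexp2l ?max_card ?orbT //.
  by apply/card_gt0P; exists None.
move=> F sF F0.
have [||X [domX antiX]] := @minimal_dominating (flex_le F).
- by move=> x; apply/flex_leP.
- move=> y x z /flex_leP xy /flex_leP yz; apply/flex_leP=> C fC /(xy C fC).
  exact: yz.
exists X; first exact: rmax (realizable_of_family freeG F0 sF domX antiX).
move=> C fC /set0Pn[x xC]; have [y yX /flex_leP xy] := domX x.
by apply/pred0Pn; exists y; rewrite /= yX xy.
Qed.
End UpperBound.

(** * Copies and embeddings *)

Section Copies.
Variables (U : finType) (H : sgraph U).

Definition image_graph (V : finType) (f : U -> V) : {set V} * {set {set V}} :=
  (f @: [set: U], [set f @: (e : {set U}) | e in edges H]).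

Lemma card_copies_le (V : finType) (G : sgraph V) :
  #|copies H G| <= #|embeddings H G|.
Proof.
apply: leq_trans (leq_imset_card (fun f : {ffun U -> V} => image_graph f) _).
apply: subset_leq_card; apply/subsetP=> -[X D]; rewrite inE.
move=> /andP[/andP[/= sDG _]] /existsP[f /and3P[fI /eqP /= XE /eqP /= DE]].
apply/imsetP; exists f; last by rewrite /image_graph XE DE.
apply/embeddingsP; split; first exact/injectiveP.
move=> x y xy; have : f @: [set x; y] \in D by rewrite -DE; apply: imset_f.
by move/(subsetP sDG); rewrite imsetU !imset_set1.
Qed.

Lemma image_graph_copy (V : finType) (G : sgraph V) (f : {ffun U -> V}) :
  f \in embeddings H G -> image_graph f \in copies H G.
Proof.
move=> /embeddingsP[fI fH]; rewrite inE; apply/andP; split.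
  apply/andP; split=> /=.
    apply/subsetP=> _ /imsetP[e /edgeP[x [y [-> xy]]] ->].
    by rewrite imsetU !imset_set1; apply: fH.
  by apply/forall_inP=> _ /imsetP[e _ ->]; apply/imsetS/subsetT.
by apply/existsP; exists f; rewrite !eqxx !andbT; apply/injectiveP.
Qed.
End Copies.

Lemma graph_of_rel (V : finType) (R : rel V) :
  symmetric R -> irreflexive R -> exists G : sgraph V, adj G =2 R.
Proof.
move=> Rsym Rirr; pose E := [set [set z.1; z.2] | z in [set z : V * V | R z.1 z.2]].
have E2 : [forall (e | e \in E), #|e| == 2].
  apply/forall_inP=> e /imsetP[[x y] /=]; rewrite inE /= => xy ->.
  rewrite cards2; have [Exy|] // := eqVneq x y; by rewrite Exy Rirr in xy.
exists (SGraph E2) => x y; rewrite /adj /=; apply/imsetP/idP => [[[a b] /=]|xy].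
  rewrite inE /= => ab Exy.
  have xab : x \in [set a; b] by rewrite -Exy !inE eqxx.
  have axy : a \in [set x; y] by rewrite Exy !inE eqxx.
  have bxy : b \in [set x; y] by rewrite Exy !inE eqxx orbT.
  move: xab axy bxy ab; rewrite !inE => /orP[]/eqP->.
    by move=> _ /orP[]/eqP-> //; rewrite Rirr.
  by move=> /orP[]/eqP-> _ //; rewrite ?Rirr // Rsym.
by exists (x, y); rewrite ?inE.
Qed.

(** * The lower bound *)

Section LowerBound.
Variables (U W : finType) (H : sgraph U) (T : sgraph W).

(** The graph G is the blow-up of H around A with t.+1 copies, placed on part of
    the n vertices. A function c from the k labels to the copies yields an
    embedding of H, where a vertex x outside A is taken from copy c (l x); c can
    be read off from the vertex set of the resulting copy of H. *)
Lemma blowup_bound k n t : no_isolated T -> realizable H T k ->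
  #|U| * t.+1 <= n -> t.+1 ^ k <= ex n H T.
Proof.
move=> niT [A [l [safeA sepA <-]]] Un.
have le_n : #|{: U * 'I_t.+1}| <= n by rewrite card_prod card_ord.
pose e (z : U * 'I_t.+1) := widen_ord le_n (enum_rank z).
have eI : injective e by move=> z w [/val_inj/enum_rank_inj].
(* A vertex of A is represented by its copy of index 0; its other copies, which
   are not vertices of the blow-up, become isolated vertices of G. *)
pose vertex (z : U * 'I_t.+1) := (z.1 \in A) ==> (z.2 == ord0).
pose B z w := [&& adj H z.1 w.1, vertex z, vertex w &
  [|| z.1 \in A, w.1 \in A | z.2 == w.2]].
have Bsym z w : B z w = B w z.
  by rewrite /B adj_sym eq_sym [in LHS]orbCA [vertex z && _]andbCA.
pose R v w := [exists z, exists z', [&& e z == v, e z' == w & B z z']].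
have RP v w : reflect (exists z z', [/\ v = e z, w = e z' & B z z']) (R v w).
  apply: (iffP existsP) => [[z /existsP[z' /and3P[/eqP<- /eqP<- zz']]]|].
    by exists z, z'.
  by case=> z [z' [-> -> zz']]; exists z; apply/existsP; exists z'; rewrite !eqxx.
have Rsym : symmetric R.
  by move=> v w; apply/RP/RP=> -[z [z' [-> -> zz']]]; exists z', z; rewrite Bsym.
have Rirr : irreflexive R.
  move=> v; apply/RP=> -[z [z' [-> /eI<-]]]; rewrite /B adj_irr.
  by [].
have [G GR] := graph_of_rel Rsym Rirr.
have freeG : is_free T G.
  apply: contraT => /not_freeP[f fI fT].
  (* Isolated vertices of G are not used by T, as T has none. *)
  have dec p : exists z, f p = e z /\ vertex z.
    have [q /fT] := niT p; rewrite GR => /RP[z [z' [-> _ /and4P[_ vz _ _]]]].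
    by exists z.
  have [d dP] := fin_all_exists dec.
  have [|p [q [npq psipq c]]] := safeA (fun p => (d p).1) (fun p => (d p).2 : nat).
    move=> p q /fT; rewrite GR => /RP[z [z' [Ep Eq]]].
    have -> : z = d p by apply: eI; rewrite -Ep (dP p).1.
    have -> : z' = d q by apply: eI; rewrite -Eq (dP q).1.
    by case/and4P.
  case/eqP: npq; apply: fI; rewrite (dP p).1 (dP q).1; congr e.
  have [vp vq] := ((dP p).2, (dP q).2).
  apply/eqP; rewrite -pair_eqE /pair_eq psipq eqxx /=.
  case/orP: c => // pA; move: vp vq; rewrite /vertex /= -psipq pA.
  by move=> /eqP-> /eqP->.
apply: leq_trans (leq_bigmax_cond _ freeG).
set L := l @: (~: A).
pose f (c : {ffun U -> 'I_t.+1}) : {ffun U -> 'I_n} :=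
  [ffun x => e (x, if x \in A then ord0 else c (l x))].
have fE c x : f c x = e (x, if x \in A then ord0 else c (l x)) by rewrite ffunE.
have f_emb c : f c \in embeddings H G.
  apply/embeddingsP; split=> [x y|x y xy]; first by rewrite !fE => /eI[].
  rewrite GR !fE; apply/RP; do 2!eexists; split=> //.
  rewrite /B /vertex /= xy; have [xA|xA] /= := boolP (x \in A).
    by case: (y \in A).
  have [//|yA] /= := boolP (y \in A).
  by rewrite (sepA x y).
rewrite -[X in X ^ _]card_ord -(card_pffun_on ord0 (mem L) predT).
rewrite -(card_in_imset (f := fun c => image_graph H (f c))).
  apply: subset_leq_card; apply/subsetP=> _ /imsetP[c _ ->].
  exact: image_graph_copy.
move=> c c' /pffun_onP[/subsetP cL _] /pffun_onP[/subsetP cL' _] [E _].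
apply/ffunP=> y; have [|yL] := boolP (y \in L); last first.
  have out (d : {ffun U -> 'I_t.+1}) :
      {subset ord0.-support d <= mem L} -> d y = ord0.
    by move=> dL; apply: contraNeq yL => dy; apply: dL.
  by rewrite !out.
case/imsetP=> x; rewrite inE => xA ->.
have : f c x \in f c' @: [set: U] by rewrite -E; apply: imset_f.
case/imsetP=> x' _; rewrite !fE (negPf xA) => /eI[<-].
by rewrite (negPf xA).
Qed.

(** Around the set of all vertices, the blow-up is H itself. *)
Lemma realizable0 : is_free T H -> realizable H T 0.
Proof.
move=> freeH; exists setT, id; split=> [psi kappa hom|x y|]; last first.
- by rewrite setCT imset0 cards0.
- by rewrite inE.
have [/injectiveP psiI|] := boolP (injectiveb psi).
  suff : ~~ is_free T H by rewrite freeH.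
  by apply/not_freeP; exists psi => // p q /hom[].
by case/injectivePn=> p [q npq pq]; exists p, q; rewrite inE.
Qed.

Lemma realizable_le k : realizable H T k -> k <= #|U|.
Proof. by move=> [A [l [_ _ <-]]]; apply: max_card. Qed.

End LowerBound.

(** * The order of magnitude *)

Section Order.
Variables (U W : finType) (H : sgraph U) (T : sgraph W) (r : nat).
Hypotheses (treeT : is_tree T) (niT : no_isolated T).
Hypotheses (real_r : realizable H T r) (max_r : forall k, realizable H T k -> k <= r).

Lemma ex_upper : exists2 K, 0 < K & forall n, 0 < n -> ex n H T <= K * n ^ r.
Proof.
eexists; last first.
  move=> n n0; apply/bigmax_leqP=> G freeG.
  apply: leq_trans (card_copies_le _ _) _.
  have := @embeddings_bound U W H T treeT _ G r _ freeG max_r.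
  by rewrite card_ord; apply.
by rewrite expn_gt0; apply/orP; left; apply/card_gt0P; exists None.
Qed.

(** The number of copies in the blow-up is n %/ #|U|.+1 rather than n %/ #|U|,
    which allows H to have no vertices; it is positive for #|U| < n, hence at
    least n divided by 2 * #|U|.+1. *)
Lemma ex_lower n : #|U| < n -> n ^ r <= (2 * #|U|.+1) ^ r * ex n H T.
Proof.
move=> Un; set h := #|U|.+1; have q0 : 0 < n %/ h by rewrite divn_gt0.
have le : #|U| * (n %/ h).-1.+1 <= n.
  by rewrite prednK // mulnC (leq_trans _ (leq_divM n h)) // leq_mul2l leqnSn orbT.
apply: leq_trans (leq_mul (leqnn _) (blowup_bound niT real_r le)).
rewrite prednK // -expnMn; have [->//|r0] := posnP r.
rewrite leq_exp2r // -mulnA mul2n -addnn; apply: leq_trans (ltnW (ltn_ceil n (ltn0Sn #|U|))) _.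
by rewrite -/h mulSn (mulnC _ h) leq_add2r leq_pmulr.
Qed.
End Order.

From mathcomp Require Import all_order all_algebra.
From mathcomp Require Import all_classical all_reals all_analysis.
Import numFieldNormedType.Exports.

Lemma realizable_max (U W : finType) (H : sgraph U) (T : sgraph W) :
  is_free T H ->
  exists2 r, realizable H T r & forall k, realizable H T k -> k <= r.
Proof.
move=> freeH; pose P k := `[< realizable H T k >].
have Pex : exists k, P k by exists 0; apply/asboolP/realizable0.
have Pub k : P k -> k <= #|U| by move=> /asboolP/realizable_le.
case: (ex_maxnP Pex Pub) => r /asboolP rr rmax; exists r => // k /asboolP.
exact: rmax.
Qed.

Import Order.TTheory GRing.Theory Num.Theory.
Local Open Scope classical_set_scope.
Local Open Scope ring_scope.

Lemma natr_Theta (R : realType) (f g : nat -> nat) (a b n0 : nat) : (0 < a)%N ->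
  (0 < b)%N ->
  (forall n, (n0 < n)%N -> (g n <= a * f n)%N /\ (f n <= b * g n)%N) ->
  (fun n => (f n)%:R : R) =Theta_\oo (fun n => (g n)%:R).
Proof.
move=> a0 b0 fg; rewrite eqThetaE qualifE; apply/asboolP.
exists (a%:R^-1, b%:R) => /=; first by rewrite invr_gt0 !ltr0n a0.
exists n0.+1 => // n /= /fg[gf fgn]; rewrite !normr_nat; split.
  by rewrite ler_pdivrMl ?ltr0n // -natrM ler_nat.
by rewrite -natrM ler_nat.
Qed.

Theorem theorem1 (U W : finType) (H : sgraph U) (T : sgraph W)
    (H_no_isolated : no_isolated H)
    (T_tree : is_tree T)
    (T_no_isolated : no_isolated T)
    (H_T_free : is_free T H) :
  exists r : nat, forall R : realType,
    (fun n : nat => (ex n H T)%:R : R) =Theta_\oo (fun n : nat => n%:R ^+ r).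
Proof.
have [r real_r max_r] := realizable_max H_T_free.
have [K K0 upper] := ex_upper T_tree max_r.
exists r => R.
have -> : (fun n => n%:R ^+ r) = (fun n => (n ^ r)%:R) :> (nat -> R).
  by apply/funext=> n; rewrite natrX.
apply: (@natr_Theta _ _ _ ((2 * #|U|.+1) ^ r)%N K #|U|) => // [|n Un].
  by rewrite expn_gt0.
split; first exact: ex_lower.
by apply: upper; apply: leq_ltn_trans Un.
Qed.
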